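(* Let $\epsilon\in(0,1]$, $\delta\in(0,1/3]$, $\rho\in(0,0.001]$, let $n,k$ be positive integers and $t\le 1/(300\rho)$ a positive integer, and let $\mathcal{P}$ be a symmetric property of distributions over $[n]$. Suppose there are distributions $p_0,p_1,\dots,p_t$ over $[n]$ such that $p_0\in\mathcal{P}$, $p_t$ is $\epsilon$-far from $\mathcal{P}$, and there are priors $\mathcal{D}_0,\dots,\mathcal{D}_t$ such that each $\mathcal{D}_i$ is a probability distribution supported on $\{p_i^\pi:\pi \text{ a permutation of }[n]\}$, and for every $1\le i\le t$ the distribution of a sample set $X^{(i)}$ of size $k$ drawn from $\mathcal{D}_i$ and that of a sample set $X^{(i-1)}$ of size $k$ drawn from $\mathcal{D}_{i-1}$ have total variation distance at most $1/2$. Then no $\rho$-replicable algorithm using $k$ samples is an $(\epsilon,\delta)$-tester for $\mathcal{P}$.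
   Context: A property $\mathcal{P}$ is a set of distributions over $[n]$; it is symmetric if $p\circ\pi\in\mathcal{P}$ for all $p\in\mathcal{P}$ and all permutations $\pi$ of $[n]$. $p$ is $\epsilon$-far from $\mathcal{P}$ if its total variation distance to every member of $\mathcal{P}$ is at least $\epsilon$. For a permutation $\pi$, $p^\pi:=p\circ\pi^{-1}$. An $(\epsilon,\delta)$-tester for $\mathcal{P}$ using $k$ samples takes $k$ i.i.d. samples from $p$ and outputs accept with probability at least $1-\delta$ if $p\in\mathcal{P}$ and reject with probability at least $1-\delta$ if $p$ is $\epsilon$-far from $\mathcal{P}$. ''A sample set $X$ of size $k$ drawn from $\mathcal{D}$'' means: first draw a distribution $d\sim\mathcal{D}$, then draw $k$ i.i.d. samples from $d$. An algorithm $\mathcal{A}(X;r)$ is $\rho$-replicable if for every distribution $\mathcal{D}$ on $[n]$, $\Pr_{X,X'\sim\mathcal{D}^{\otimes k},r}[\mathcal{A}(X;r)=\mathcal{A}(X';r)]\ge1-\rho$ (independent $X,X'$, shared randomness $r$). *)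

(* Defs.v *)
From HB Require Import structures.
From mathcomp Require Import all_boot all_order all_algebra all_fingroup.
From mathcomp Require Import finmap.
From mathcomp Require Import all_classical all_reals all_analysis.

Set Implicit Arguments.
Unset Strict Implicit.
Unset Printing Implicit Defensive.

Import Order.TTheory GRing.Theory Num.Theory.

Local Open Scope classical_set_scope.
Local Open Scope ring_scope.

(* Finitely supported distributions.  A [\sum_(x \in A)] whose terms have
   infinite support is 0 by convention, so [fdist_sum1] forces the support to be
   finite.  [T] need not be finite: a prior is a [fdist] over [fdist R 'I_n]. *)
Record fdist (R : realType) (T : choiceType) := FDist {
  pmf :> T -> R;
  fdist_ge0 : forall x, 0 <= pmf x;
  fdist_sum1 : \sum_(x \in [set: T]) pmf x = 1 }.

HB.instance Definition _ (R : realType) (T : choiceType) :=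
  gen_eqMixin (fdist R T).
HB.instance Definition _ (R : realType) (T : choiceType) :=
  gen_choiceMixin (fdist R T).

Lemma fsum_finType (R : realType) (T : finType) (f : T -> R) :
  \sum_(x \in [set: T]) f x = \sum_x f x.
Proof.
rewrite (@fsbigE _ _ _ _ _ (index_enum T)) ?index_enum_uniq//.
  by apply: eq_bigl => x; rewrite in_setT.
by move=> x _; rewrite mem_index_enum.
Qed.

Definition tv (R : realType) (T : finType) (p q : fdist R T) : R :=
  2^-1 * \sum_x `|p x - q x|.

Section relabel.
Variables (R : realType) (n : nat) (p : fdist R 'I_n) (s : {perm 'I_n}).

Lemma fdist_comp_ge0 i : 0 <= p (s i). Proof. exact: fdist_ge0. Qed.

Lemma fdist_comp_sum1 : \sum_(i \in [set: 'I_n]) p (s i) = 1.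
Proof.
by rewrite fsum_finType -[RHS](fdist_sum1 p) fsum_finType [RHS](reindex_perm s).
Qed.

Definition fdist_comp : fdist R 'I_n := FDist fdist_comp_ge0 fdist_comp_sum1.

End relabel.

Definition fdist_perm (R : realType) (n : nat) (p : fdist R 'I_n)
  (s : {perm 'I_n}) : fdist R 'I_n := fdist_comp p s^-1%g.

Notation sample n k := {ffun 'I_k -> 'I_n}.

Section iid.
Variables (R : realType) (n k : nat) (p : fdist R 'I_n).

Definition iid_pmf (x : sample n k) : R := \prod_(j < k) p (x j).

Lemma iid_ge0 x : 0 <= iid_pmf x.
Proof. by apply: prodr_ge0 => j _; exact: fdist_ge0. Qed.

Lemma iid_sum1 : \sum_(x \in [set: sample n k]) iid_pmf x = 1.
Proof.
rewrite fsum_finType /iid_pmf -(bigA_distr_bigA (fun _ : 'I_k => p)) big1// => j _.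
by rewrite -fsum_finType fdist_sum1.
Qed.

Definition iid : fdist R (sample n k) := FDist iid_ge0 iid_sum1.

End iid.

Section mixture.
Variables (R : realType) (n k : nat) (D : fdist R (fdist R 'I_n)).

Definition mixture_pmf (x : sample n k) : R :=
  \sum_(q \in [set: fdist R 'I_n]) D q * iid k q x.

Lemma mixture_ge0 x : 0 <= mixture_pmf x.
Proof. by apply: fsumr_ge0 => q _; apply: mulr_ge0; exact: fdist_ge0. Qed.

Lemma mixture_sum1 : \sum_(x \in [set: sample n k]) mixture_pmf x = 1.
Proof.
have Dfin : finite_set ([set: fdist R 'I_n] `&` D @^-1` [set~ 0]).
  apply: contrapT => Dinf; have := fdist_sum1 D.
  by rewrite (no_finite_support Dinf) big_nil => /esym/eqP; rewrite oner_eq0.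
set S := fset_set ([set: fdist R 'I_n] `&` D @^-1` [set~ 0]).
have DS q : q \notin S -> D q = 0.
  move=> qS; apply: contrapT => Dq; move: qS.
  by rewrite in_fset_set// => /negP; apply; rewrite inE.
rewrite fsum_finType /mixture_pmf.
have mixE x : \sum_(q \in [set: fdist R 'I_n]) D q * iid k q x =
    \sum_(q <- S) D q * iid k q x.
  by apply: fsbigTE => q /DS ->; rewrite mul0r.
under eq_bigr do rewrite mixE.
rewrite exchange_big -[RHS](fdist_sum1 D) [RHS](@fsbigTE _ _ _ _ S)//.
apply: eq_bigr => q _.
by rewrite -mulr_sumr -fsum_finType fdist_sum1 mulr1.
Qed.

(* The law of a sample set of size [k] drawn from the prior [D]: the draw [q]
   from [D] is made once and shared by the [k] samples. *)
Definition mixture : fdist R (sample n k) := FDist mixture_ge0 mixture_sum1.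

End mixture.

Definition symmetric_property (R : realType) (n : nat)
    (P : set (fdist R 'I_n)) : Prop :=
  forall (p : fdist R 'I_n) (s : {perm 'I_n}), P p -> P (fdist_comp p s).

Definition far (R : realType) (n : nat) (eps : R) (P : set (fdist R 'I_n))
    (p : fdist R 'I_n) : Prop :=
  forall q : fdist R 'I_n, P q -> eps <= tv p q.

Definition orbit_supported (R : realType) (n : nat)
    (D : fdist R (fdist R 'I_n)) (p : fdist R 'I_n) : Prop :=
  forall q : fdist R 'I_n, D q != 0 -> exists s : {perm 'I_n}, q = fdist_perm p s.

(* A randomized algorithm: [A x r] is its output on the sample [x] and the random
   string [r], an element of an arbitrary probability space; [true] is accept. *)
Notation algorithm n k Omega := (sample n k -> {mfun Omega >-> bool}).

Section algorithms.
Variables (R : realType) (n k : nat) (d : measure_display).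
Variables (Omega : measurableType d) (mu : probability Omega R).
Variable A : algorithm n k Omega.

Definition output_prob (p : fdist R 'I_n) (b : bool) : R :=
  \sum_(x : sample n k) iid k p x * fine (mu [set r | A x r = b]).

Definition agree_prob (p : fdist R 'I_n) : R :=
  \sum_(x : sample n k) \sum_(x' : sample n k)
    iid k p x * iid k p x' * fine (mu [set r | A x r = A x' r]).

Definition tester (eps delta : R) (P : set (fdist R 'I_n)) : Prop :=
  forall p : fdist R 'I_n,
    (P p -> 1 - delta <= output_prob p true) /\
    (far eps P p -> 1 - delta <= output_prob p false).

Definition replicable (rho : R) : Prop :=
  forall p : fdist R 'I_n, 1 - rho <= agree_prob p.

End algorithms.

(* Main.v *)
Require Import Defs.
From HB Require Import structures.
From mathcomp Require Import all_boot all_order all_algebra all_fingroup.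
From mathcomp Require Import finmap.
From mathcomp Require Import all_classical all_reals all_analysis.
From mathcomp Require Import ring lra.

Set Implicit Arguments.
Unset Strict Implicit.
Unset Printing Implicit Defensive.

Import Order.TTheory GRing.Theory Num.Theory.

Local Open Scope classical_set_scope.
Local Open Scope ring_scope.

(** Averaging over all relabellings replaces the prior [D i] by the uniform law
    on the orbit of [p i] without increasing the total variation distances.
    Consecutive symmetrized sample laws then overlap in a part of mass at least
    1/2 whose density [h] is invariant under relabelling, so [h] has the same
    mean under the samples of every single member of the orbit.  Replicability
    makes the output nearly independent of the sample for each member, hence
    nearly uncorrelated with [h]; the acceptance probability on the overlap is
    thus close to the one on either orbit, and the two orbit averages differ by
    at most [2 * rho].  Over [t] steps this is at most 1/150, whereas a tester
    needs a gap of 1/3. *)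

(** * Covariance with a bounded function *)

(** A covariance is half the mean of [(h x - h y) * (a x - a y)] over two independent draws, and
    [h x - h y] has absolute value at most 1. *)
Lemma covariance_le (R : realType) (T : finType) (Q : fdist R T) (h a : T -> R) :
  (forall x, 0 <= h x <= 1) ->
  `|\sum_x Q x * (h x * a x) - (\sum_x Q x * h x) * (\sum_x Q x * a x)| <=
  2^-1 * \sum_x \sum_y Q x * Q y * `|a x - a y|.
Proof.
move=> h01.
have Q1 : \sum_x Q x = 1 by rewrite -fsum_finType fdist_sum1.
have -> : \sum_x Q x * (h x * a x) - (\sum_x Q x * h x) * (\sum_x Q x * a x) =
    2^-1 * \sum_x \sum_y Q x * Q y * ((h x - h y) * (a x - a y)).
  have E (f g : T -> R) : \sum_x \sum_y Q x * f x * (Q y * g y) =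
      (\sum_x Q x * f x) * (\sum_x Q x * g x).
    by rewrite mulr_suml; apply: eq_bigr => x _; rewrite mulr_sumr.
  have Q1' : \sum_x Q x * 1 = 1 by under eq_bigr do rewrite mulr1.
  have E1 := E (fun x => h x * a x) (fun=> 1).
  have E2 := E (fun=> 1) (fun x => h x * a x).
  have E3 := E h a.
  have E4 := E a h.
  have -> : \sum_x \sum_y Q x * Q y * ((h x - h y) * (a x - a y)) =
      \sum_x \sum_y Q x * (h x * a x) * (Q y * 1) +
      \sum_x \sum_y Q x * 1 * (Q y * (h y * a y)) -
      \sum_x \sum_y Q x * h x * (Q y * a y) -
      \sum_x \sum_y Q x * a x * (Q y * h y).
    rewrite -big_split /= -!sumrB; apply: eq_bigr => x _ /=.
    rewrite -big_split /= -!sumrB; apply: eq_bigr => y _ /=; ring.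
  by rewrite E1 E2 E3 E4 Q1'; field.
rewrite normrM (ger0_norm (_ : 0 <= 2^-1)) ?invr_ge0 ?ler0n//.
rewrite ler_wpM2l ?invr_ge0 ?ler0n//.
apply: (le_trans (ler_norm_sum _ _ _)); apply: ler_sum => x _.
apply: (le_trans (ler_norm_sum _ _ _)); apply: ler_sum => y _.
have QQ : 0 <= Q x * Q y by rewrite mulr_ge0 ?fdist_ge0.
rewrite normrM (ger0_norm QQ) ler_wpM2l// normrM ler_piMl//.
have := h01 x; have := h01 y; rewrite ler_norml; lra.
Qed.

(** * Relabelling distributions and samples *)

Lemma tv_fdist_comp (R : realType) (n : nat) (p q : fdist R 'I_n) (s : {perm 'I_n}) :
  tv (fdist_comp p s) q = tv p (fdist_comp q s^-1%g).
Proof.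
rewrite /tv; congr (_ * _); rewrite (reindex_perm s^-1%g).
by apply: eq_bigr => i _ /=; rewrite permKV.
Qed.

Lemma far_fdist_comp (R : realType) (n : nat) (eps : R) (P : set (fdist R 'I_n))
    (p : fdist R 'I_n) (s : {perm 'I_n}) :
  symmetric_property P -> far eps P p -> far eps P (fdist_comp p s).
Proof. by move=> symP fp q Pq; rewrite tv_fdist_comp; exact/fp/symP. Qed.

(** An infinite support would make the total mass 0 by convention, not 1. One [S] serves every [f],
    so sums over a prior can be exchanged with finite sums. *)
Lemma fdist_fsum_seq (R : realType) (T : choiceType) (D : fdist R T) :
  exists S : seq T, forall f : T -> R,
    \sum_(q \in [set: T]) D q * f q = \sum_(q <- S) D q * f q.
Proof.
have Dfin : finite_set ([set: T] `&` D @^-1` [set~ 0]).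
  apply: contrapT => Dinf; have := fdist_sum1 D.
  by rewrite (no_finite_support Dinf) big_nil => /esym/eqP; rewrite oner_eq0.
exists (fset_set ([set: T] `&` D @^-1` [set~ 0])) => f.
apply: fsbigTE => q; rewrite in_fset_set// => /negP qS.
suff -> : D q = 0 by rewrite mul0r.
by apply: contrapT => Dq; apply: qS; rewrite inE.
Qed.

Definition relabel_sample (n k : nat) (s : {perm 'I_n}) (x : sample n k) :
  sample n k := [ffun j => s (x j)].

Lemma relabel_sampleM (n k : nat) (s u : {perm 'I_n}) (x : sample n k) :
  relabel_sample (s * u)%g x = relabel_sample u (relabel_sample s x).
Proof. by apply/ffunP => j; rewrite !ffunE permM. Qed.

Lemma relabel_sample_inj (n k : nat) (s : {perm 'I_n}) :
  injective (@relabel_sample n k s).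
Proof.
by move=> x y /ffunP xy; apply/ffunP => j; have := xy j; rewrite !ffunE => /perm_inj.
Qed.

Lemma iid_fdist_comp (R : realType) (n k : nat) (p : fdist R 'I_n)
    (s : {perm 'I_n}) (x : sample n k) :
  iid k (fdist_comp p s) x = iid k p (relabel_sample s x).
Proof. by apply: eq_bigr => j _; rewrite ffunE. Qed.

(** * Averages over all permutations *)

Definition perm_mean (R : realType) (n : nat) (F : {perm 'I_n} -> R) : R :=
  #|{perm 'I_n}|%:R^-1 * \sum_s F s.

Lemma card_perm_gt0 (R : realType) (n : nat) : 0 < #|{perm 'I_n}|%:R :> R.
Proof. by rewrite ltr0n; apply/card_gt0P; exists 1%g. Qed.

Lemma perm_mean_const (R : realType) (n : nat) (c : R) :
  perm_mean (fun=> c : R) (n := n) = c.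
Proof.
rewrite /perm_mean sumr_const -(mulr_natl c) mulrA mulVf ?mul1r//.
by rewrite gt_eqF// card_perm_gt0.
Qed.

Lemma ler_perm_mean (R : realType) (n : nat) (F G : {perm 'I_n} -> R) :
  (forall s, F s <= G s) -> perm_mean F <= perm_mean G.
Proof.
move=> FG; rewrite ler_wpM2l ?invr_ge0 ?ler0n//.
by apply: ler_sum => s _; exact: FG.
Qed.

Lemma perm_meanB (R : realType) (n : nat) (F G : {perm 'I_n} -> R) :
  perm_mean (fun s => F s - G s) = perm_mean F - perm_mean G.
Proof. by rewrite /perm_mean sumrB mulrBr. Qed.

Lemma perm_meanZ (R : realType) (n : nat) (c : R) (F : {perm 'I_n} -> R) :
  perm_mean (fun s => c * F s) = c * perm_mean F.
Proof. by rewrite /perm_mean -mulr_sumr mulrCA. Qed.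

Lemma ler_norm_perm_mean (R : realType) (n : nat) (F : {perm 'I_n} -> R) :
  `|perm_mean F| <= perm_mean (fun s => `|F s|).
Proof.
rewrite /perm_mean normrM ger0_norm ?invr_ge0 ?ler0n//.
by rewrite ler_wpM2l ?invr_ge0 ?ler0n// ler_norm_sum.
Qed.

Lemma sum_perm_mean (R : realType) (n : nat) (T : finType)
    (F : {perm 'I_n} -> T -> R) :
  \sum_x perm_mean (F ^~ x) = perm_mean (fun s => \sum_x F s x).
Proof. by rewrite /perm_mean -mulr_sumr exchange_big. Qed.

(** * Orbit laws and their overlap *)

(** The sample law under the uniform prior on the orbit of [p]. Since the average runs over the
    whole group, [fdist_comp] and [fdist_perm] give the same law. *)
Definition orbit_pmf (R : realType) (n k : nat) (p : fdist R 'I_n)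
    (x : sample n k) : R :=
  perm_mean (fun s => iid k (fdist_comp p s) x).

Arguments orbit_pmf {R n} k p x.

Lemma orbit_pmf_ge0 (R : realType) (n k : nat) (p : fdist R 'I_n)
  (x : sample n k) : 0 <= orbit_pmf k p x.
Proof.
rewrite mulr_ge0 ?invr_ge0 ?ler0n// sumr_ge0// => s _; exact: fdist_ge0.
Qed.

Lemma sum_orbit_pmfM (R : realType) (n k : nat) (p : fdist R 'I_n)
    (f : sample n k -> R) :
  \sum_x orbit_pmf k p x * f x =
  perm_mean (fun s => \sum_x iid k (fdist_comp p s) x * f x).
Proof.
rewrite -sum_perm_mean; apply: eq_bigr => x _.
rewrite mulrC -perm_meanZ; congr (_ * _).
by apply: eq_bigr => s _; rewrite mulrC.
Qed.

Lemma orbit_pmf_sum1 (R : realType) (n k : nat) (p : fdist R 'I_n) :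
  \sum_x orbit_pmf k p x = 1.
Proof.
rewrite sum_perm_mean -[RHS](perm_mean_const n); congr (_ * _).
by apply: eq_bigr => s _; rewrite -fsum_finType fdist_sum1.
Qed.

Lemma orbit_pmf_relabel (R : realType) (n k : nat) (p : fdist R 'I_n)
    (s : {perm 'I_n}) (x : sample n k) :
  orbit_pmf k p (relabel_sample s x) = orbit_pmf k p x.
Proof.
congr (_ * _); rewrite [RHS](reindex_inj (mulgI s)).
by apply: eq_bigr => u _; rewrite !iid_fdist_comp relabel_sampleM.
Qed.

(** Every member of the orbit has the same orbit average as [p], so symmetrizing the sample law
    erases the choice of prior. *)
Lemma orbit_pmf_mixture (R : realType) (n k : nat) (p : fdist R 'I_n)
    (D : fdist R (fdist R 'I_n)) (x : sample n k) :
  orbit_supported D p ->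
  orbit_pmf k p x = perm_mean (fun s => mixture k D (relabel_sample s x)).
Proof.
move=> Dp; have [S DS] := fdist_fsum_seq D.
have D1 : \sum_(q <- S) D q = 1.
  transitivity (\sum_(q <- S) D q * 1); first by apply: eq_bigr => q _; rewrite mulr1.
  by rewrite -(DS (fun=> 1)) -[RHS](fdist_sum1 D); under eq_fsbigr do rewrite mulr1.
rewrite /perm_mean /mixture/= /mixture_pmf.
under eq_bigr do rewrite DS.
(* Multiplying the left side by the total mass of [D] turns both sides into [D]-averages, compared
   term by term. *)
rewrite exchange_big mulr_sumr -[LHS]mul1r -[X in X * _ = _]D1 mulr_suml.
apply: eq_bigr => q _; rewrite -mulr_sumr [RHS]mulrCA.
have [->|/Dp[u ->]] := eqVneq (D q) 0; first by rewrite !mul0r.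
rewrite /orbit_pmf /perm_mean; congr (_ * (_ * _)).
(* Right translation of the group absorbs the permutation [u] that produced this orbit member. *)
rewrite [LHS](reindex_inj (mulIg u^-1%g)).
by apply: eq_bigr => s _; rewrite !iid_fdist_comp relabel_sampleM.
Qed.

(** Symmetrizing is an average, so the triangle inequality applies pointwise; each relabelling
    permutes the samples and preserves the sum of the absolute differences. *)
Lemma dist_orbit_pmf_le (R : realType) (n k : nat) (p q : fdist R 'I_n)
    (D E : fdist R (fdist R 'I_n)) :
  orbit_supported D p -> orbit_supported E q ->
  2^-1 * \sum_x `|orbit_pmf k p x - orbit_pmf k q x| <=
  tv (mixture k D) (mixture k E).
Proof.
move=> Dp Eq; rewrite /tv ler_wpM2l ?invr_ge0 ?ler0n//.
set d := fun x => `|mixture k D x - mixture k E x|.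
have le x : `|orbit_pmf k p x - orbit_pmf k q x| <=
    perm_mean (fun s => d (relabel_sample s x)).
  rewrite (orbit_pmf_mixture _ Dp) (orbit_pmf_mixture _ Eq) -perm_meanB.
  exact: ler_norm_perm_mean.
apply: (le_trans (ler_sum _ (fun x _ => le x))).
rewrite sum_perm_mean -[leRHS](perm_mean_const n); apply: ler_perm_mean => s.
by rewrite [leRHS](reindex_inj (@relabel_sample_inj n k s)).
Qed.

(* An invariant [h] has the same mean under every relabelling of [p], so the
   covariances of [h] and [a] under these relabellings average to the
   covariance under the orbit law. *)
Lemma covariance_orbit_le (R : realType) (n k : nat) (p : fdist R 'I_n)
    (h a : sample n k -> R) (c : R) :
  (forall x, 0 <= h x <= 1) ->
  (forall s x, h (relabel_sample s x) = h x) ->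
  (forall s, \sum_x \sum_y iid k (fdist_comp p s) x * iid k (fdist_comp p s) y *
     `|a x - a y| <= c) ->
  `|\sum_x orbit_pmf k p x * (h x * a x) -
    (\sum_x orbit_pmf k p x * h x) * (\sum_x orbit_pmf k p x * a x)| <= 2^-1 * c.
Proof.
move=> h01 hs ac; rewrite !sum_orbit_pmfM.
have hE s : \sum_x iid k (fdist_comp p s) x * h x = \sum_x iid k p x * h x.
  rewrite [RHS](reindex_inj (@relabel_sample_inj n k s)).
  by apply: eq_bigr => x _; rewrite hs iid_fdist_comp.
have -> : perm_mean (fun s => \sum_x iid k (fdist_comp p s) x * h x) =
    \sum_x iid k p x * h x.
  rewrite -[RHS](perm_mean_const n); congr (_ * _).
  by apply: eq_bigr => s _; exact: hE.
rewrite -perm_meanZ -perm_meanB; apply: (le_trans (ler_norm_perm_mean _)).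
rewrite -[leRHS](perm_mean_const n); apply: ler_perm_mean => s.
rewrite -(hE s); apply: (le_trans (covariance_le _ _ h01)).
by rewrite ler_wpM2l ?invr_ge0 ?ler0n.
Qed.

(* The overlap of the two orbit laws has mass at least 1/2, and its density [h]
   with respect to either of them is invariant. *)
Lemma orbit_mean_dist_le (R : realType) (n k : nat) (p q : fdist R 'I_n)
    (a : sample n k -> R) (c : R) :
  2^-1 * \sum_x `|orbit_pmf k p x - orbit_pmf k q x| <= 1 / 2 ->
  (forall p' : fdist R 'I_n,
     \sum_x \sum_y iid k p' x * iid k p' y * `|a x - a y| <= c) ->
  `|\sum_x orbit_pmf k p x * a x - \sum_x orbit_pmf k q x * a x| <= 2 * c.
Proof.
move=> pq ac.
pose m x := Num.min (orbit_pmf k p x) (orbit_pmf k q x).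
have m0 x : 0 <= m x by rewrite le_min !orbit_pmf_ge0.
have cov (u : fdist R 'I_n) : (forall x, m x <= orbit_pmf k u x) ->
    `|\sum_x m x * a x - (\sum_x m x) * (\sum_x orbit_pmf k u x * a x)| <= 2^-1 * c.
  move=> mu.
  (* Where the orbit law vanishes the quotient is 0 by convention, and [m x] is 0 too, squeezed
     between 0 and that law. *)
  have mE x : orbit_pmf k u x * (m x / orbit_pmf k u x) = m x.
    have [u0|u0] := eqVneq (orbit_pmf k u x) 0; last by rewrite mulrC divfK.
    by apply/eqP; rewrite u0 mul0r eq_le m0/= -u0 mu.
  have -> : \sum_x m x * a x =
      \sum_x orbit_pmf k u x * (m x / orbit_pmf k u x * a x).
    by apply: eq_bigr => x _; rewrite mulrA mE.
  have -> : \sum_x m x = \sum_x orbit_pmf k u x * (m x / orbit_pmf k u x).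
    by apply: eq_bigr => x _; rewrite mE.
  apply: covariance_orbit_le => [x|s x|s]; last exact: ac.
  - rewrite divr_ge0 ?orbit_pmf_ge0//=.
    have [u0|u0] := eqVneq (orbit_pmf k u x) 0; first by rewrite u0 invr0 mulr0 ler01.
    by rewrite ler_pdivrMr ?mul1r ?mu// lt_neqAle eq_sym u0 orbit_pmf_ge0.
  - by rewrite /m !orbit_pmf_relabel.
have := cov p (fun x => ltac:(by rewrite /m ge_min lexx)).
have := cov q (fun x => ltac:(by rewrite /m ge_min lexx orbT)).
(* As [min(a, b)] is half of [a + b - |a - b|], the overlap has mass 1 minus the total variation
   distance. *)
have mass : 1 / 2 <= \sum_x m x.
  have -> : \sum_x m x =
      1 - 2^-1 * \sum_x `|orbit_pmf k p x - orbit_pmf k q x|.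
    have half2 : 2^-1 * (1 + 1) = 1 :> R by field.
    transitivity (2^-1 * (\sum_x orbit_pmf k p x + \sum_x orbit_pmf k q x) -
        2^-1 * \sum_x `|orbit_pmf k p x - orbit_pmf k q x|); last first.
      by rewrite !orbit_pmf_sum1 half2.
    rewrite -mulrBr -big_split -sumrB mulr_sumr; apply: eq_bigr => x _.
    by rewrite /m minr_absE mulrC.
  lra.
move: (\sum_x m x * a x) mass => z; move: (\sum_x m x) => w.
move: (\sum_x orbit_pmf k p x * a x) (\sum_x orbit_pmf k q x * a x) => g g'.
move=> w2 zg' zg.
(* Both covariance bounds involve the same [z] and [w]; eliminating [z] adds the two errors [c / 2].
   Dividing by [w >= 1/2] then gives the factor 2. *)
have H : w * `|g - g'| <= c.
  have w0 : 0 <= w by lra.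
  rewrite -{1}(ger0_norm w0) -normrM.
  have -> : w * (g - g') = (z - w * g') - (z - w * g) by ring.
  apply: (le_trans (ler_normB _ _)); lra.
have : 1 / 2 * `|g - g'| <= w * `|g - g'| by rewrite ler_wpM2r.
lra.
Qed.

(** * Telescoping along the chain *)

Lemma telescope_dist_le (R : realType) (t : nat) (g : 'I_t.+1 -> R) (c : R) :
  (forall i j : 'I_t.+1, i = j.+1 :> nat -> `|g i - g j| <= c) ->
  `|g ord_max - g ord0| <= t%:R * c.
Proof.
move=> gc.
have H m : (m <= t)%N -> `|g (inord m) - g ord0| <= m%:R * c.
  elim: m => [|m IH] mt.
    by rewrite mul0r (_ : inord 0 = ord0) ?subrr ?normr0//; apply: val_inj; rewrite /= inordK.
  have -> : g (inord m.+1) - g ord0 =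
    (g (inord m.+1) - g (inord m)) + (g (inord m) - g ord0) by ring.
  rewrite (le_trans (ler_normD _ _))// -natr1 mulrDl mul1r addrC lerD ?IH 1?ltnW//.
  by apply: gc; rewrite !inordK// ltnW.
by have := H t (leqnn t); rewrite (_ : inord t = ord_max)//; apply: val_inj; rewrite /= inordK.
Qed.

(** * Acceptance probabilities under replicability *)

Section accept.
Variables (R : realType) (n k : nat) (d : measure_display).
Variables (Omega : measurableType d) (mu : probability Omega R).
Variable A : algorithm n k Omega.

Definition accept_prob (x : sample n k) : R := fine (mu [set r | A x r = true]).

Lemma measurable_output x (b : bool) : measurable [set r | A x r = b].
Proof.
exact: (measurable_funPTI (A x) (Y := [set b])).
Qed.

Lemma output_prob_true p :
  output_prob mu A p true = \sum_x iid k p x * accept_prob x.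
Proof. by []. Qed.

Lemma output_prob_false p :
  output_prob mu A p false = 1 - \sum_x iid k p x * accept_prob x.
Proof.
have -> : 1 = \sum_x iid k p x by rewrite -fsum_finType fdist_sum1.
rewrite -sumrB; apply: eq_bigr => x _; rewrite -[X in X - _]mulr1 -mulrBr.
congr (_ * _); rewrite /accept_prob.
have -> : [set r | A x r = false] = ~` [set r | A x r = true].
  by apply/seteqP; split => r /=; case: (A x r).
rewrite probability_setC; last exact: measurable_output.
by rewrite fineB// ?fin_num_measure//; exact: measurable_output.
Qed.

(** The acceptance events of [x] and [y] differ only at random strings where the two outputs
    disagree. *)
Lemma dist_accept_prob_le x y :
  `|accept_prob x - accept_prob y| <= 1 - fine (mu [set r | A x r = A y r]).
Proof.
pose T z : set Omega := [set r | A z r = true].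
have mT z : measurable (T z) by exact: measurable_output.
have E : [set r | A x r = A y r] = (T x `&` T y) `|` (~` T x `&` ~` T y).
  apply/seteqP; split => r; rewrite /T /=.
    by case: (A x r) => <-; [left|right].
  case=> -[]; first by move=> -> ->.
  by case: (A x r) => //; case: (A y r).
have mE : measurable [set r | A x r = A y r].
  by rewrite E; apply: measurableU; apply: measurableI => //; apply: measurableC.
have fm (B : set Omega) : measurable B -> mu B \is a fin_num.
  by move=> mB; rewrite fin_num_measure.
(* The one-sided bound, stated for arbitrary [z] and [w], yields both signs of the absolute
   value. *)
have sub z w : T z `<=` T w `|` ~` [set r | A x r = A y r] ->
    accept_prob z - accept_prob w <= 1 - fine (mu [set r | A x r = A y r]).
  move=> zw; rewrite lerBlDl -lee_fin EFinD EFinB !fineK;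
    [|by apply: fm; first [exact: mE|exact: mT]..].
  rewrite -probability_setC//.
  apply: (le_trans (le_measure mu _ _ zw)); rewrite ?inE//.
    by apply: measurableU => //; apply: measurableC.
  by apply: measureU2 => //; apply: measurableC.
rewrite ler_norml lerNl opprB !sub// => r; rewrite /T /=;
  by case: (A x r); case: (A y r) => // _; first [by left|by right].
Qed.

Lemma replicable_dist_accept_prob (rho : R) (p : fdist R 'I_n) :
  replicable mu A rho ->
  \sum_x \sum_y iid k p x * iid k p y * `|accept_prob x - accept_prob y| <= rho.
Proof.
move=> /(_ p) rep.
have QQ1 : \sum_x \sum_y iid k p x * iid k p y = 1.
  under eq_bigr do rewrite -mulr_sumr -fsum_finType fdist_sum1 mulr1.
  by rewrite -fsum_finType fdist_sum1.
apply: (@le_trans _ _ (1 - agree_prob mu A p)); last lra.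
rewrite -QQ1 /agree_prob -sumrB; apply: ler_sum => x _.
rewrite -sumrB; apply: ler_sum => y _.
rewrite -[X in _ <= X - _]mulr1 -mulrBr ler_wpM2l ?dist_accept_prob_le//.
by rewrite mulr_ge0 ?fdist_ge0.
Qed.

End accept.

(** * Contradiction between the two ends of the chain *)

Theorem mainTheorem2 (R : realType) (eps delta rho : R) (n k t : nat)
    (heps : 0 < eps <= 1) (hdelta : 0 < delta <= 1 / 3)
    (hrho : 0 < rho <= 1 / 1000)
    (hn : (0 < n)%N) (hk : (0 < k)%N) (ht : (0 < t)%N)
    (htrho : t%:R <= 1 / (300 * rho))
    (P : set (fdist R 'I_n)) (hP : symmetric_property P)
    (p : 'I_t.+1 -> fdist R 'I_n)
    (hp0 : P (p ord0)) (hpt : far eps P (p ord_max))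
    (D : 'I_t.+1 -> fdist R (fdist R 'I_n))
    (hD : forall i : 'I_t.+1, orbit_supported (D i) (p i))
    (htv : forall i j : 'I_t.+1, i = j.+1 :> nat ->
      tv (mixture k (D i)) (mixture k (D j)) <= 1 / 2)
    (d : measure_display) (Omega : measurableType d) (mu : probability Omega R)
    (A : algorithm n k Omega) :
  replicable mu A rho -> ~ tester mu A eps delta P.
Proof.
move=> rep test.
pose g (i : 'I_t.+1) := \sum_x orbit_pmf k (p i) x * accept_prob mu A x.
have step (i j : 'I_t.+1) : i = j.+1 :> nat -> `|g i - g j| <= 2 * rho.
  move=> ij; apply: orbit_mean_dist_le => [|q]; last exact: replicable_dist_accept_prob.
  exact: le_trans (dist_orbit_pmf_le k (hD i) (hD j)) (htv i j ij).
(* By symmetry every relabelling of [p ord0] lies in [P], so each term of the average is at least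
   [1 - delta >= 2/3]. *)
have g0 : 2 / 3 <= g ord0.
  rewrite /g sum_orbit_pmfM -[leLHS](perm_mean_const n); apply: ler_perm_mean => s.
  rewrite -output_prob_true.
  have := (test (fdist_comp (p ord0) s)).1 (hP _ _ hp0); lra.
(* Relabelling preserves farness, so each term is at most [delta <= 1/3]. *)
have gt : g ord_max <= 1 / 3.
  rewrite /g sum_orbit_pmfM -[leRHS](perm_mean_const n); apply: ler_perm_mean => s.
  have := (test (fdist_comp (p ord_max) s)).2 (far_fdist_comp s hP hpt).
  rewrite output_prob_false; lra.
(* Only the lower bound on [g ord_max - g ord0] is kept: it is at least [-1/150], while the two end
   bounds force it to be at most [-1/3]. *)
have := telescope_dist_le step; rewrite ler_norml => /andP[+ _].
have : t%:R * rho <= 1 / 300.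
  by move: htrho; rewrite ler_pdivlMr; lra.
lra.
Qed.
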